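(* Let $\nu,N\in\mathcal N$ and suppose that $P^{(a)}_m(\nu,N)\ge 0$ for every $(a,m)\in H'(N)$. Then the number of off-diagonal solutions $(z^{(a)}_{m\alpha})$ of the string center equation of pattern $N$ (for the quantum space datum $\nu$), divided by $\prod_{(a,m)\in H'(N)}N^{(a)}_m!$, is equal to $R(\nu,N)$.
   Context: Lie data. Fix an affine type $X^{(r)}_N$ among $A^{(1)}_n\,(n\ge1)$, $B^{(1)}_n\,(n\ge3)$, $C^{(1)}_n\,(n\ge2)$, $D^{(1)}_n\,(n\ge4)$, $E^{(1)}_n\,(n=6,7,8)$, $F^{(1)}_4$, $G^{(1)}_2$, $A^{(2)}_{2n}\,(n\ge1)$, $A^{(2)}_{2n-1}\,(n\ge2)$, $D^{(2)}_{n+1}\,(n\ge2)$, $E^{(2)}_6$, $D^{(3)}_4$. Let $\mathfrak g=X_N$ be the simple Lie algebra of rank $N$ and $\sigma$ a Dynkin diagram automorphism of order $r$ ($\sigma=\mathrm{id}$ if $r=1$); let $\mathfrak g_0$ be the $\sigma$-invariant subalgebra: $\mathfrak g_0=X_N$ if $r=1$ (then $n=N$), and $\mathfrak g_0=B_n,C_n,B_n,F_4,G_2$ for $A^{(2)}_{2n},A^{(2)}_{2n-1},D^{(2)}_{n+1},E^{(2)}_6,D^{(3)}_4$ respectively; $n=\mathrm{rank}\,\mathfrak g_0$. Cartan matrices use the convention $A_{ij}=2(\alpha_i,\alpha_j)/(\alpha_i,\alpha_i)$. Let $A'=(A'_{ij})_{i,j\in\{1,\dots,N\}}$ be the Cartan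 matrix of $\mathfrak g$ and $A=(A_{ab})_{a,b\in\{1,\dots,n\}}$ that of $\mathfrak g_0$, whose nodes correspond to the $\sigma$-orbits of nodes of $\mathfrak g$; labelings are chosen so that node $a\in\{1,\dots,n\}$ of $\mathfrak g$ lies in the orbit corresponding to node $a$ of $\mathfrak g_0$ and $A_{ab}<0\iff A'_{ab}<0$ for $a,b\le n$ (for $A^{(2)}_{2n}$: $\mathfrak g=A_{2n}$, nodes $1,\dots,2n$ along the chain, $\sigma(i)=2n+1-i$). Let $d'_i$ be the coprime positive integers with $(d'_iA'_{ij})$ symmetric, and $d_a$ the coprime positive integers with $(d_aA_{ab})$ symmetric. Put $\epsilon'_i=r$ if $\sigma(i)=i$ and $1$ otherwise; $\epsilon_a=2$ if $A'_{a\sigma(a)}<0$ and $1$ otherwise. Combinatorial data. $H=\{(a,m): a\in\{1,\dots,n\},\ m\in\mathbb Z_{\ge1}\}$; $\mathcal N$ is the set of families $N=(N^{(a)}_m)_{(a,m)\in H}$ of nonnegative integers with $\sum N^{(a)}_m<\infty$; $H'(N)=\{(a,m)\in H: N^{(a)}_m>0\}$. For $\nu,N\in\mathcal N$ and $(a,m)\in H$: $\gamma^{(a)}_m=\sum_{k\ge1}\min(m,k)\nu^{(a)}_k$, $P^{(a)}_m(\nu,N)=\gamma^{(a)}_m-\sum_{(b,k)\in H}\frac{A_{ab}}{\epsilon_a d'_b}\min(d'_am,d'_bk)N^{(b)}_k$, $\hat P^{(a)}_m(\nu,N)=\gamma^{(a)}_m-\sum_{(b,k)\in H}\frac{A'_{ab}}{d'_b}\min(d'_am,d'_bk)N^{(b)}_k$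 (these are integers). Writing $P^{(a)}_m$ for $P^{(a)}_m(\nu,N)$, define for triples $(a,m,\alpha),(b,k,\beta)$ with $(a,m),(b,k)\in H'(N)$, $1\le\alpha\le N^{(a)}_m$, $1\le\beta\le N^{(b)}_k$: $A_{am\alpha,bk\beta}=\delta_{ab}\delta_{mk}\delta_{\alpha\beta}(P^{(a)}_m+N^{(a)}_m)+\frac{A_{ba}}{\epsilon_bd'_a}\min(d'_am,d'_bk)-\delta_{ab}\delta_{mk}$. String center equation (SCE) of pattern $N$: the system in unknowns $z^{(a)}_{m\alpha}\in\mathbb C^\times$ ($(a,m)\in H'(N)$, $1\le\alpha\le N^{(a)}_m$) $\prod_{(b,k)\in H'(N)}\prod_{\beta=1}^{N^{(b)}_k}(z^{(b)}_{k\beta})^{A_{am\alpha,bk\beta}}=(-1)^{\hat P^{(a)}_m+N^{(a)}_m+1}$ for all $(a,m)\in H'(N)$, $1\le\alpha\le N^{(a)}_m$. A solution is off-diagonal if $z^{(a)}_{m\alpha}=z^{(a)}_{m\beta}$ only when $\alpha=\beta$. The number $R(\nu,N)$: $R(\nu,0)=1$, and for $N\ne0$, $R(\nu,N)=\Big(\det_{(a,m),(b,k)\in H'(N)}F_{am,bk}\Big)\prod_{(a,m)\in H'(N)}\frac1{N^{(a)}_m}\binom{P^{(a)}_m+N^{(a)}_m-1}{N^{(a)}_m-1}$, where $F_{am,bk}=\delta_{ab}\delta_{mk}P^{(a)}_m+\frac{A_{ba}}{\epsilon_bd'_a}\min(d'_am,d'_bk)N^{(b)}_k$ and $\binom{k}{j}=\frac{\Gamma(k+1)}{\Gamma(k-j+1)\Gamma(j+1)}$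 (for integer $j\ge0$ this is $k(k-1)\cdots(k-j+1)/j!$). *)

(* Defs.v *)
(* Complex numbers are modelled as  R[i]  (mathcomp-real-closed
   [complex]) for an arbitrary  R : realType  (any two realTypes are isomorphic
   to the field of real numbers). *)
From mathcomp Require Import all_boot all_order all_algebra.
From mathcomp Require Import reals complex.
Set Implicit Arguments.
Unset Strict Implicit.
Unset Printing Implicit Defensive.
Import Order.TTheory GRing.Theory Num.Theory.

Inductive simple_type : Type :=
  | TA of nat | TB of nat | TC of nat | TD of nat
  | TE of nat | TF4 | TG2.

(* Cartan matrix of a simple Lie algebra in Bourbaki labelling, nodes 1..N,
   with the convention  A_ij = 2 (alpha_i, alpha_j) / (alpha_i, alpha_i).
   (So for B_N, alpha_N short:  A_{N,N-1} = -2, A_{N-1,N} = -1;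
    for C_N, alpha_N long:      A_{N-1,N} = -2, A_{N,N-1} = -1;
    for F_4, alpha_1,alpha_2 long: A_{3,2} = -2, A_{2,3} = -1;
    for G_2, alpha_1 short:     A_{1,2} = -3, A_{2,1} = -1.)
   Entries outside 1..N are irrelevant junk (0). *)
Definition chain_adj (i j : nat) : bool := (i == j.+1) || (j == i.+1).

Definition E_adj (i j : nat) : bool :=
  let e x y := ((i == x) && (j == y)) || ((i == y) && (j == x)) in
  [|| e 1 3, e 3 4, e 4 5, e 5 6, e 6 7, e 7 8 | e 2 4]%N.

Definition D_adj (N i j : nat) : bool :=
  ((chain_adj i j) && (i <= N.-1) && (j <= N.-1))
  || ((i == N.-2) && (j == N)) || ((i == N) && (j == N.-2)).

Definition cartan (X : simple_type) (i j : nat) : int :=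
  let N := match X with
           | TA N | TB N | TC N | TD N | TE N => N | TF4 => 4 | TG2 => 2 end in
  if ~~ ((1 <= i <= N) && (1 <= j <= N))%N then 0%R
  else if i == j then 2%R
  else match X with
  | TA _ => if chain_adj i j then (-1)%R else 0%R
  | TB _ => if chain_adj i j then
              (if (i == N) && (j == N.-1) then (-2)%R else (-1)%R) else 0%R
  | TC _ => if chain_adj i j then
              (if (i == N.-1) && (j == N) then (-2)%R else (-1)%R) else 0%R
  | TD _ => if D_adj N i j then (-1)%R else 0%R
  | TE _ => if E_adj i j then (-1)%R else 0%R
  | TF4 => if chain_adj i j then
              (if (i == 3) && (j == 2) then (-2)%R else (-1)%R) else 0%R
  | TG2 => if (i == 1) && (j == 2) then (-3)%R else (-1)%R
  end.

(* Coprime positive integers d_i with (d_i A_ij) symmetric, i.e. proportional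
   to the squared root lengths (alpha_i, alpha_i). *)
Definition symmetrizer (X : simple_type) (i : nat) : nat :=
  match X with
  | TB N => if i == N then 1 else 2
  | TC N => if i == N then 2 else 1
  | TF4 => if i <= 2 then 2 else 1
  | TG2 => if i == 2 then 3 else 1
  | _ => 1
  end.

Inductive affine_type : Type :=
  | A1 of nat
  | B1 of nat
  | C1 of nat
  | D1 of nat
  | E1 of nat
  | F1_4
  | G1_2
  | A2_even of nat   (* A^{(2)}_{2n}, n >= 1 *)
  | A2_odd of nat    (* A^{(2)}_{2n-1}, n >= 2 *)
  | D2 of nat        (* D^{(2)}_{n+1}, n >= 2 *)
  | E2_6
  | D3_4.

Definition valid_type (t : affine_type) : bool :=
  match t with
  | A1 n => 1 <= n | B1 n => 3 <= n | C1 n => 2 <= n | D1 n => 4 <= n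
  | E1 n => (n == 6) || (n == 7) || (n == 8)
  | F1_4 | G1_2 => true
  | A2_even n => 1 <= n | A2_odd n => 2 <= n | D2 n => 2 <= n
  | E2_6 | D3_4 => true
  end.

Definition twist (t : affine_type) : nat :=
  match t with
  | A2_even _ | A2_odd _ | D2 _ | E2_6 => 2
  | D3_4 => 3
  | _ => 1
  end.

(* g0 = sigma-invariant subalgebra, nodes 1..n *)
Definition g0_type (t : affine_type) : simple_type :=
  match t with
  | A1 n => TA n | B1 n => TB n | C1 n => TC n | D1 n => TD n | E1 n => TE n
  | F1_4 => TF4 | G1_2 => TG2
  | A2_even n => TB n | A2_odd n => TC n | D2 n => TB n
  | E2_6 => TF4 | D3_4 => TG2
  end.

Definition rank0 (t : affine_type) : nat :=
  match t with
  | A1 n | B1 n | C1 n | D1 n | E1 n | A2_even n | A2_odd n | D2 n => n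
  | F1_4 | E2_6 => 4
  | G1_2 | D3_4 => 2
  end.

(* The labelling of E_6 used for E^{(2)}_6: our node i is the Bourbaki node
   E6_perm i, chosen so that nodes 1,2,3,4 of g lie in the sigma-orbits
   corresponding to nodes 1,2,3,4 of F_4 (Bourbaki, 1,2 long) and
   A_ab < 0 <-> A'_ab < 0 for a,b <= 4. *)
Definition E6_perm (i : nat) : nat :=
  match i with 1 => 2 | 2 => 4 | 3 => 3 | 4 => 1 | 5 => 5 | 6 => 6 | _ => 0 end.

Definition cartan_g (t : affine_type) (i j : nat) : int :=
  match t with
  | A2_even n => cartan (TA (2 * n)) i j
  | A2_odd n => cartan (TA (2 * n).-1) i j
  | D2 n => cartan (TD n.+1) i j
  | E2_6 => cartan (TE 6) (E6_perm i) (E6_perm j)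
  | D3_4 => cartan (TD 4) i j
  | _ => cartan (g0_type t) i j
  end.

Definition cartan_g0 (t : affine_type) (a b : nat) : int := cartan (g0_type t) a b.

(* the diagram automorphism sigma of g (identity if r = 1) *)
Definition sigma (t : affine_type) (i : nat) : nat :=
  match t with
  | A2_even n => (2 * n).+1 - i
  | A2_odd n => 2 * n - i
  | D2 n => if i == n then n.+1 else if i == n.+1 then n else i
  | E2_6 => match i with 3 => 5 | 5 => 3 | 4 => 6 | 6 => 4 | _ => i end
  | D3_4 => match i with 1 => 3 | 3 => 4 | 4 => 1 | _ => i end
  | _ => i
  end.

(* d'_i : symmetrizer of the Cartan matrix of g *)
Definition dprime (t : affine_type) (i : nat) : nat :=
  if twist t == 1 then symmetrizer (g0_type t) i else 1.

Definition eps (t : affine_type) (a : nat) : nat :=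
  if (cartan_g t a (sigma t a) < 0)%R then 2 else 1.

Local Open Scope ring_scope.

(* A famH (N^{(a)}_m)_{(a,m) in H} is encoded as a function nat -> nat -> nat
   (a, m are 1-based; values outside H are ignored).  K is a bound such that
   the families vanish for m > K (see [supported]); all sums over H below run
   over 1 <= a <= n, 1 <= m <= K. *)
Definition famH := nat -> nat -> nat.

Definition supported (t : affine_type) (K : nat) (f : famH) : Prop :=
  forall a m, (1 <= a <= rank0 t)%N -> (K < m)%N -> f a m = 0%N.

Section Comb.
Variables (t : affine_type) (K : nat) (nu N : famH).

Let n := rank0 t.
Let A a b : rat := (cartan_g0 t a b)%:~R.
Let A' a b : rat := (cartan_g t a b)%:~R.
Let d' i : rat := (dprime t i)%:R.
Let ep a : rat := (eps t a)%:R.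
Let mn (x y : nat) : rat := (minn x y)%:R.

Definition gammaH (a m : nat) : rat :=
  \sum_(1 <= k < K.+1) mn m k * (nu a k)%:R.

Definition Pvac (a m : nat) : rat :=
  gammaH a m
  - \sum_(1 <= b < n.+1) \sum_(1 <= k < K.+1)
      A a b / (ep a * d' b) * mn (dprime t a * m) (dprime t b * k) * (N b k)%:R.

Definition Phat (a m : nat) : rat :=
  gammaH a m
  - \sum_(1 <= b < n.+1) \sum_(1 <= k < K.+1)
      A' a b / d' b * mn (dprime t a * m) (dprime t b * k) * (N b k)%:R.

Definition Hprime : seq (nat * nat) :=
  [seq am <- [seq (a, m) | a <- iota 1 n, m <- iota 1 K] | (0 < N am.1 am.2)%N].

Definition zindex : seq ((nat * nat) * nat) :=
  [seq (am, al) | am <- Hprime, al <- iota 1 (N am.1 am.2)].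

(* the exponent A_{a m alpha, b k beta} (a rational number, in fact an integer) *)
Definition Aexp (x y : (nat * nat) * nat) : rat :=
  let: ((a, m), al) := x in
  let: ((b, k), be) := y in
  (if (a == b) && (m == k) && (al == be) then Pvac a m + (N a m)%:R else 0)
  + A b a / (ep b * d' a) * mn (dprime t a * m) (dprime t b * k)
  - (if (a == b) && (m == k) then 1 else 0).

Definition Fmat (x y : nat * nat) : rat :=
  let: (a, m) := x in
  let: (b, k) := y in
  (if (a == b) && (m == k) then Pvac a m else 0)
  + A b a / (ep b * d' a) * mn (dprime t a * m) (dprime t b * k) * (N b k)%:R.

Definition binomq (x : rat) (j : nat) : rat :=
  (\prod_(i < j) (x - i%:R)) / (j`!)%:R.

Definition Rnum : rat :=
  if Hprime == [::] then 1
  else \det (\matrix_(i < size Hprime, j < size Hprime)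
                Fmat (nth (0, 0)%N Hprime i) (nth (0, 0)%N Hprime j))
       * \prod_(am <- Hprime)
           ((N am.1 am.2)%:R^-1 * binomq (Pvac am.1 am.2 + (N am.1 am.2)%:R - 1)
                                          (N am.1 am.2).-1).

(* integer-valued quantities are computed in rat; [numq] recovers the integer *)
Definition toZ (q : rat) : int := numq q.

Definition is_SCE_solution (R : realType)
    (z : {ffun 'I_(size zindex) -> R[i]}) : Prop :=
  (forall i, z i != 0) /\
  forall i : 'I_(size zindex),
    let x := nth ((0, 0), 0)%N zindex i in
    \prod_(j < size zindex) z j ^ toZ (Aexp x (nth ((0, 0), 0)%N zindex j))
    = (-1) ^ (toZ (Phat x.1.1 x.1.2) + (N x.1.1 x.1.2)%:Z + 1).

Definition off_diagonal (R : realType)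
    (z : {ffun 'I_(size zindex) -> R[i]}) : Prop :=
  forall i j : 'I_(size zindex),
    (nth ((0, 0), 0)%N zindex i).1 = (nth ((0, 0), 0)%N zindex j).1 ->
    z i = z j ->
    (nth ((0, 0), 0)%N zindex i).2 = (nth ((0, 0), 0)%N zindex j).2.

End Comb.
Arguments is_SCE_solution : clear implicits.
Arguments off_diagonal : clear implicits.

(* Main.v *)
(* All entries z_{a m alpha} of one string have the same power of exponent
   M = P + N, so dividing them by the first entry of the string leaves distinct M-th
   roots of unity with first entry 1: there are (M - 1) ... (M - N + 1) choices for
   each string.  Once these ratios are fixed, the first entries solve a system of
   monomial equations on a torus with exponent matrix F, which has |det F| solutions
   whatever its right-hand side, by the Smith normal form; in particular the signs of
   the string center equation play no role.  Finally det F > 0, because after a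
   positive rescaling of its columns F is the sum of a nonnegative diagonal matrix and
   of the Gram-type matrix G_ab min(d'_a m, d'_b k), where G is a positive definite
   symmetrization of the Cartan matrix of g_0. *)
Require Import Defs.
From mathcomp Require Import all_boot all_order all_algebra.
From mathcomp Require Import boolp reals complex separable.
From mathcomp Require Import zify ring lra.
Set Implicit Arguments.
Unset Strict Implicit.
Unset Printing Implicit Defensive.
Import Order.TTheory GRing.Theory Num.Theory.
Local Open Scope ring_scope.

(** * Counting solutions *)

(** The sets to be counted lie in types of complex-valued functions, which are not finite types, so
    a cardinal is witnessed by a duplicate-free list. *)
Definition has_card (T : eqType) (P : T -> Prop) (k : nat) : Prop :=
  exists s : seq T, [/\ uniq s, forall x, x \in s <-> P x & size s = k].

Lemma has_card_image (T U : eqType) (P : T -> Prop) (Q : U -> Prop) k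
    (f : T -> U) :
  (forall x, P x -> Q (f x)) -> (forall y, Q y -> exists2 x, P x & y = f x) ->
  (forall x x', P x -> P x' -> f x = f x' -> x = x') ->
  has_card P k -> has_card Q k.
Proof.
move=> PQ QP f_inj [s [us sP <-]]; exists (map f s); split.
- by rewrite map_inj_in_uniq // => x y /sP Px /sP Py; apply: f_inj.
- move=> y; split=> [/mapP[x /sP Px ->]|/QP[x Px ->]]; first exact: PQ.
  exact/map_f/sP.
- exact: size_map.
Qed.

Lemma has_card_pred (T : finType) (A : {pred T}) :
  has_card (fun x => x \in A) #|A|.
Proof.
exists (enum A); rewrite enum_uniq -cardE; split=> // x; by rewrite mem_enum.
Qed.

(** Fibred counting: [g] identifies the set to be counted with the pairs of a base point [j] and a
    point of the fibre over [j], all fibres having the same size. *)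
Lemma has_card_sum (J U T : eqType) (S : J -> Prop) (Q : J -> U -> Prop)
    (P : T -> Prop) (g : J -> U -> T) m k :
  has_card S m -> (forall j, S j -> has_card (Q j) k) ->
  (forall j u, S j -> Q j u -> P (g j u)) ->
  (forall z, P z -> exists j u, [/\ S j, Q j u & z = g j u]) ->
  (forall j u j' u', S j -> Q j u -> S j' -> Q j' u' ->
     g j u = g j' u' -> j = j' /\ u = u') ->
  has_card P (m * k).
Proof.
move=> [S0 [uS SP szS]] cQ QP PQ g_inj.
have /choice[s sP] : forall j, exists s : seq U, j \in S0 ->
    [/\ uniq s, forall x, x \in s <-> Q j x & size s = k].
  move=> j; have [/SP/cQ[s ?]|_] := boolP (j \in S0); last by exists [::].
  by exists s.
have {}QE j u : j \in S0 -> u \in s j <-> Q j u by case/sP.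
exists [seq g j u | j <- S0, u <- s j]; split.
- apply: allpairs_uniq_dep => // [j /sP[]//|[j u] [j' u']].
  move=> /allpairsPdep[j1 [u1 [j1S /(QE _ _ j1S) q1 e1]]].
  move=> /allpairsPdep[j2 [u2 [j2S /(QE _ _ j2S) q2 e2]]].
  rewrite e1 e2 /= => eg.
  by have [-> ->] := g_inj _ _ _ _ (proj1 (SP _) j1S) q1 (proj1 (SP _) j2S) q2 eg.
- move=> z; split=> [/allpairsPdep[j [u [jS /(QE _ _ jS) q ->]]]|].
    by apply: QP => //; apply/SP.
  move=> /PQ[j [u [/SP jS q ->]]].
  by apply/allpairsPdep; exists j, u; split=> //; apply/QE.
- rewrite size_allpairs_dep sumnE big_map (eq_big_seq (fun=> k)) => [|j /sP[]//].
  by rewrite big_const_seq count_predT iter_addn_0 szS mulnC.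
Qed.

Lemma foldr_muln_prod (I : finType) (F : I -> nat) :
  foldr muln 1%N [seq F i | i : I] = (\prod_i F i)%N.
Proof. by rewrite /image_mem foldr_map -big_enum unlock. Qed.

Lemma has_card_prod (I : finType) (T : eqType) (P : I -> T -> Prop)
    (k : I -> nat) :
  (forall i, has_card (P i) (k i)) ->
  has_card (fun v : {ffun I -> T} => forall i, P i (v i)) (\prod_i k i).
Proof.
move=> /choice[s sP].
have sE i x : x \in s i <-> P i x by case: (sP i).
(* A vector of solutions is encoded by the positions of its entries in the lists [s i], which turns
   the count into the cardinal of a finite type. *)
pose J := {dffun forall i, 'I_(size (s i))}.
have -> : (\prod_i k i = #|{: J}|)%N.
  rewrite card_dep_ffun foldr_muln_prod.
  by apply: eq_bigr => i _; rewrite card_ord; case: (sP i).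
apply: (has_card_image
  (f := fun j : J => [ffun i => tnth (in_tuple (s i)) (j i)])
  _ _ _ (has_card_pred {: J})) => [j _ i|z Pz|].
- by rewrite ffunE; apply/sE/mem_tnth.
- have lt_i i : (index (z i) (s i) < size (s i))%N by rewrite index_mem; apply/sE.
  exists [ffun i => Ordinal (lt_i i)] => //.
  apply/ffunP => i; rewrite !ffunE (tnth_nth (z i)) /= nth_index //.
  exact/sE.
- move=> j j' _ _ /ffunP e; apply/ffunP => i.
  have := e i; rewrite !ffunE; apply: tuple_uniqP.
  by case: (sP i).
Qed.

(** * Monomial systems on a torus *)

Section TorusSystems.
Variable C : numClosedFieldType.

(** The polynomial ['X^d - c] splits, and it is separable: its derivative vanishes at most at 0,
    which is not a root. *)
Lemma has_card_root d (c : C) :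
  (0 < d)%N -> c != 0 -> has_card (fun x : C => x ^+ d = c) d.
Proof.
move=> d_gt0 c_neq0; pose p : {poly C} := 'X^d - c%:P.
have [s ps] := closed_field_poly_normal p.
have mon_p : p \is monic by apply: monicXnsubC.
rewrite (monicP mon_p) scale1r in ps.
have root_s x : (x \in s) = (x ^+ d == c).
  by rewrite -root_prod_XsubC -ps rootE !hornerE subr_eq0.
exists s; split.
- rewrite -separable_prod_XsubC -ps unlock derivB derivC subr0 derivXn -scaler_nat.
  rewrite coprimepZr ?pnatr_eq0 -?lt0n // coprimep_expr //.
  rewrite -['X]subr0 -polyC0 coprimep_XsubC rootE !hornerE expr0n.
  by rewrite eqn0Ngt d_gt0 sub0r oppr_eq0.
- by move=> x; rewrite root_s; split=> [/eqP|/eqP].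
- have := congr1 (fun q : {poly C} => size q) ps.
  by rewrite size_prod_XsubC size_XnsubC // => -[].
Qed.

Lemma has_card_rootz (d : int) (c : C) :
  d != 0 -> c != 0 -> has_card (fun x : C => x != 0 /\ x ^ d = c) `|d|%N.
Proof.
move=> d_neq0 c_neq0.
(* A negative exponent is made positive by inverting [c]. *)
have [e [e_neq0 eE]] : exists e : C, e != 0 /\
    forall x : C, (x ^ d = c) <-> (x ^+ `|d| = e).
  case: (intP d) d_neq0 => // n _; first by exists c.
  exists c^-1; rewrite invr_eq0; split=> // x; rewrite abszN absz_nat -exprnN.
  by split=> [<-|->]; rewrite invrK.
have d_gt0 : (0 < `|d|)%N by rewrite absz_gt0.
have [s [us sP sz]] := has_card_root d_gt0 e_neq0.
exists s; split=> // x; rewrite sP; split=> [xe|[_ /eE]//].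
split; last exact/eE.
by apply: contra_neq e_neq0 => x0; rewrite -xe x0 expr0n eqn0Ngt d_gt0.
Qed.

Lemma prodfz_exp (I : Type) (r : seq I) (P : pred I) (f : I -> C) (k : int) :
  (\prod_(i <- r | P i) f i) ^ k = \prod_(i <- r | P i) f i ^ k.
Proof. by apply: (big_morph (fun x => x ^ k)) => [x y|]; rewrite ?expfzMl ?exp1rz. Qed.

Lemma expfz_sum (I : Type) (r : seq I) (P : pred I) (x : C) (k : I -> int) :
  x != 0 -> x ^ (\sum_(i <- r | P i) k i) = \prod_(i <- r | P i) x ^ k i.
Proof. by move=> x0; apply: (big_morph (fun k => x ^ k)) => [m n|]; rewrite ?expfzDr. Qed.

Variable n : nat.
Implicit Types (A B : 'M[int]_n) (u v : {ffun 'I_n -> C}).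

Definition torus_map A u : {ffun 'I_n -> C} :=
  [ffun i => \prod_j u j ^ A i j].

Lemma torus_map_neq0 A u :
  (forall i, u i != 0) -> forall i, torus_map A u i != 0.
Proof. by move=> u0 i; rewrite ffunE; apply/prodf_neq0 => j _; rewrite expfz_neq0. Qed.

(** Matrix products become compositions, so matrices invertible over the integers act on the torus
    by automorphisms. *)
Lemma torus_mapM A B u :
  (forall i, u i != 0) -> torus_map (A *m B) u = torus_map A (torus_map B u).
Proof.
move=> u0; apply/ffunP => i; rewrite !ffunE.
under eq_bigr => k _ do rewrite mxE expfz_sum //.
rewrite exchange_big; apply: eq_bigr => j _.
by rewrite ffunE prodfz_exp; apply: eq_bigr => k _; rewrite exprz_exp mulrC.
Qed.

Lemma torus_map1 u : torus_map 1%:M u = u.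
Proof.
apply/ffunP => i; rewrite ffunE (bigD1 i) //= mxE eqxx expr1z big1 ?mulr1 //.
by move=> j ne; rewrite mxE eq_sym (negPf ne) expr0z.
Qed.

(* The Smith normal form makes the system diagonal by an automorphism of the torus. *)
Lemma has_card_torus A (c : {ffun 'I_n -> C}) :
  \det A != 0 -> (forall i, c i != 0) ->
  has_card (fun u => (forall i, u i != 0) /\ torus_map A u = c) `|\det A|%N.
Proof.
move=> detA c0; have [L uL [Q uQ [d _ AE]]] := int_Smith_normal_form A.
set D := (\matrix_(i, j) _) in AE.
have abs_unit (M : 'M[int]_n) : M \in unitmx -> `|\det M|%N = 1%N.
  by rewrite unitmxE => /orP[] /eqP ->.
have detD : \det D = \prod_(i < n) d`_i.
  have -> : D = diag_mx (\row_i d`_i).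
    by apply/matrixP => i j; rewrite !mxE.
  by rewrite det_diag; apply: eq_bigr => i _; rewrite mxE.
have detAE : `|\det A|%N = (\prod_(i < n) `|(d`_i)%R|)%N.
  rewrite AE !det_mulmx !abszM (abs_unit L) // (abs_unit Q) // mul1n muln1 detD.
  by rewrite (big_morph _ abszM (erefl : `|1%Z|%N = 1%N)).
have d0 i : (i < n)%N -> d`_i != 0.
  move=> lt_in; apply: contra_neq detA => di0; apply/eqP.
  rewrite -absz_eq0 detAE (bigD1 (Ordinal lt_in)) //= di0.
  by rewrite mul0n.
(* With v = Q u, the system L D Q u = c becomes D v = L^-1 c, that is, one equation in one unknown
   for each coordinate. *)
pose c' := torus_map (invmx L) c.
have c'0 := torus_map_neq0 (invmx L) c0.
have torus_D v i : torus_map D v i = v i ^ d`_i.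
  rewrite ffunE (bigD1 i) //= mxE eqxx big1 ?mulr1 // => j ne.
  by rewrite mxE eq_sym val_eqE (negPf ne) expr0z.
rewrite detAE.
have card_i (i : 'I_n) := has_card_rootz (d0 i (ltn_ord i)) (c'0 i).
apply: (has_card_image (f := torus_map (invmx Q)) _ _ _ (has_card_prod card_i)).
- move=> v vP; have v0 i := (vP i).1.
  split; first exact: torus_map_neq0.
  have v'0 := torus_map_neq0 (invmx Q) v0.
  rewrite AE -mulmxA torus_mapM // torus_mapM // -[X in torus_map D X]torus_mapM //.
  rewrite mulmxV // torus_map1.
  have -> : torus_map D v = c' by apply/ffunP => i; rewrite torus_D (vP i).2.
  by rewrite -torus_mapM // mulmxV // torus_map1.
- move=> u [u0 Au]; exists (torus_map Q u) => [i|]; last first.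
    by rewrite -torus_mapM // mulVmx // torus_map1.
  split; first exact: torus_map_neq0.
  rewrite -torus_D /c' -Au AE -mulmxA torus_mapM // -[in RHS]torus_mapM.
    by rewrite mulVmx // torus_map1 torus_mapM.
  exact: torus_map_neq0.
- move=> v v' vP v'P /(congr1 (torus_map Q)).
  rewrite -!torus_mapM; [|by move=> i; case: (v'P i)|by move=> i; case: (vP i)].
  by rewrite mulmxV // !torus_map1.
Qed.

End TorusSystems.

(** * Systems whose unknowns are grouped into strings *)

Section StringSystems.
Variables (C : numClosedFieldType) (n : nat) (I : finType).
Variables (p : I -> 'I_n) (b : 'I_n -> I) (M : 'I_n -> nat).
Hypotheses (bK : cancel b p) (M_gt0 : forall h, (0 < M h)%N).

Let injective_on_strings (r : {ffun I -> C}) :=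
  forall i j, p i = p j -> r i = r j -> i = j.

(** In string [h] the base entry is 1, so the other entries form an injection into the [M h - 1]
    nontrivial roots of unity; injections are counted by falling factorials. *)
Lemma has_card_ratios :
  has_card (fun r : {ffun I -> C} =>
      [/\ forall h, r (b h) = 1, forall i, r i ^+ M (p i) = 1
        & injective_on_strings r])
    (\prod_h (M h).-1 ^_ #|[pred i | p i == h]|.-1)%N.
Proof.
have /choice[s sP] : forall h, exists s : seq C,
    [/\ uniq s, forall x, (x \in s) = (x ^+ M h == 1) && (x != 1)
      & size s = (M h).-1].
  move=> h; have [s [us sP sz]] := has_card_root (M_gt0 h) (oner_neq0 C).
  exists (rem 1 s); rewrite rem_uniq // size_rem ?sz; last first.
    by apply/sP; rewrite expr1n.
  split=> // x; rewrite mem_rem_uniq // inE andbC; congr (_ && _).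
  by apply/idP/eqP => /sP.
have us h : uniq (s h) by case: (sP h).
have mem_s h x : (x \in s h) = (x ^+ M h == 1) && (x != 1) by case: (sP h).
have sz h : size (s h) = (M h).-1 by case: (sP h).
pose D h := {i : I | (p i == h) && (i != b h)}.
pose J := {dffun forall h, {ffun D h -> 'I_(M h).-1}}.
pose A : {pred J} := family (fun h => [pred f : {ffun D h -> 'I_(M h).-1} | injectiveb f]).
(* [insub i] fails exactly when [i] is the base index of its string, and the default 1 is then the
   required value. *)
pose rho (j : J) : {ffun I -> C} :=
  [ffun i => oapp (fun d : D (p i) => (s (p i))`_(j (p i) d)) 1 (insub i)].
have rhoE j h (d : D h) : rho j (val d) = (s h)`_(j h d).
  case: d => i iP; have [/eqP e _] := andP iP; move: iP; subst h => iP.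
  by rewrite ffunE /= (insubT (fun i' => (p i' == p i) && (i' != b (p i))) iP).
have rho_b j h : rho j (b h) = 1 by rewrite ffunE insubF // bK !eqxx.
have IP i : i = b (p i) \/ exists d : D (p i), val d = i.
  have [|ne] := eqVneq i (b (p i)); first by left.
  right; have iP : (p i == p i) && (i != b (p i)) by rewrite eqxx ne.
  by exists (Sub i iP); rewrite SubK.
have rho_s j h (d : D h) : rho j (val d) \in s h.
  by rewrite rhoE mem_nth // sz.
have -> : (\prod_h (M h).-1 ^_ #|[pred i | p i == h]|.-1 = #|A|)%N.
  rewrite card_family foldr_muln_prod; apply: eq_bigr => h _.
  rewrite -[RHS]cardsE card_inj_ffuns card_ord card_sig; congr (_ ^_ _)%N.
  rewrite [in LHS](cardD1 (b h)) !inE bK eqxx /=.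
  by apply: eq_card => i; rewrite !inE andbC.
apply: (has_card_image (f := rho) _ _ _ (has_card_pred A)).
- move=> j /familyP jA; split=> [|i|i i' ii']; first exact: rho_b.
    have [->|[d <-]] := IP i; first by rewrite rho_b expr1n.
    have := rho_s j _ d; have /andP[/eqP -> _] := valP d.
    by rewrite mem_s => /andP[/eqP].
  have [->|[d <-]] := IP i; have := IP i'; rewrite -ii' => -[->|[d' <-]] //.
  + by rewrite rho_b => e; have := rho_s j _ d'; rewrite -e mem_s eqxx andbF.
  + by rewrite rho_b => e; have := rho_s j _ d; rewrite e mem_s eqxx andbF.
  rewrite !rhoE => /eqP; rewrite nth_uniq ?sz // val_eqE => /eqP e.
  by have /injectiveP/(_ _ _ e) -> := jA (p i).
- move=> r [r_b r_pow r_inj].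
  have lt h (d : D h) : (index (r (val d)) (s h) < (M h).-1)%N.
    have /andP[/eqP pd] := valP d; have := r_pow (val d).
    rewrite pd -sz index_mem mem_s => ->; rewrite eqxx /=.
    by apply: contra_neq => e; apply: r_inj; rewrite ?bK // e r_b.
  pose j : J := [ffun h => [ffun d : D h => Ordinal (lt h d)]].
  exists j.
    apply/familyP => h; apply/injectiveP => d d'; rewrite !ffunE => -[e].
    have mem_r (d1 : D h) : r (val d1) \in s h by rewrite -index_mem sz.
    apply/val_inj/r_inj; last first.
      by rewrite -(nth_index 0 (mem_r d)) e nth_index //; apply: mem_r.
    by have /andP[/eqP -> _] := valP d; have /andP[/eqP -> _] := valP d'.
  apply/ffunP => i; have [->|[d <-]] := IP i; first by rewrite rho_b r_b.
  by rewrite rhoE !ffunE /= nth_index // -index_mem sz; apply: lt.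
- move=> j j' _ _ /ffunP e; apply/ffunP => h; apply/ffunP => d.
  have := e (val d); rewrite !rhoE => /eqP.
  by rewrite nth_uniq ?sz // => /eqP/val_inj.
Qed.

Variables (B : 'I_n -> 'I_n -> int) (c : 'I_n -> C).
Hypothesis c_neq0 : forall h, c h != 0.

(** The exponent matrix left when all entries of each string are set equal to its base entry: the
    exponents [B h k] then add up over the whole string [k]. *)
Definition reduced_mx : 'M[int]_n :=
  \matrix_(h, k) ((M h)%:Z *+ (h == k) + B h k * #|[pred i | p i == k]|%:Z).

(* Dividing each string by its base entry turns its entries into distinct roots
   of unity and leaves a torus system for the base entries. *)
Lemma has_card_strings :
  \det reduced_mx != 0 ->
  has_card (fun z : {ffun I -> C} =>
      [/\ forall i, z i != 0,
          forall i, z i ^+ M (p i) * \prod_j z j ^ B (p i) (p j) = c (p i)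
        & injective_on_strings z])
    ((\prod_h (M h).-1 ^_ #|[pred i | p i == h]|.-1) * `|\det reduced_mx|)%N.
Proof.
move=> det_neq0.
pose K (r : {ffun I -> C}) h := \prod_j r j ^ B h (p j).
pose Q r (u : {ffun 'I_n -> C}) :=
  (forall h, u h != 0) /\ torus_map reduced_mx u = [ffun h => c h / K r h].
have r_neq0 (r : {ffun I -> C}) : (forall i, r i ^+ M (p i) = 1) ->
    forall i, r i != 0.
  move=> r_pow i; apply/eqP => r0; have := r_pow i.
  by rewrite r0 expr0n eqn0Ngt M_gt0 => /eqP; rewrite eq_sym oner_eq0.
have K_neq0 (r : {ffun I -> C}) h : (forall i, r i != 0) -> K r h != 0.
  by move=> r0; apply/prodf_neq0 => j _; rewrite expfz_neq0.
have redE (u : {ffun 'I_n -> C}) h : (forall k, u k != 0) ->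
    torus_map reduced_mx u h = u h ^+ M h * K [ffun i => u (p i)] h.
  move=> u0; rewrite ffunE.
  under eq_bigr => k _ do rewrite mxE expfzDr //.
  rewrite big_split (bigD1 h) //= eqxx big1 ?mulr1 => [|k]; last first.
    by rewrite eq_sym => /negPf ->.
  congr (_ * _); rewrite /K (partition_big p predT) //=; apply: eq_bigr => k _.
  rewrite (eq_bigr (fun=> u k ^ B h k)) => [|i /eqP pi]; last by rewrite ffunE pi.
  by rewrite prodr_const -exprz_exp.
have K_mul (r r' : {ffun I -> C}) h : K [ffun i => r i * r' i] h = K r h * K r' h.
  by rewrite /K -big_split; apply: eq_bigr => i _; rewrite ffunE expfzMl.
(* In the factorization of z into base entries [u] and ratios [r], the ratios contribute the factor
   [K r h], which moves to the right-hand side. *)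
have eqn_split (r : {ffun I -> C}) (u : {ffun 'I_n -> C}) h x :
    (forall i, r i ^+ M (p i) = 1) -> (forall k, u k != 0) -> x ^+ M h = u h ^+ M h ->
    (x ^+ M h * K [ffun i => u (p i) * r i] h = c h) <->
    torus_map reduced_mx u h = c h / K r h.
  move=> r_pow u0 ->; rewrite redE //.
  have -> : [ffun i => u (p i) * r i] = [ffun i => [ffun i => u (p i)] i * r i].
    by apply/ffunP => i; rewrite !ffunE.
  rewrite K_mul mulrA; have K0 := K_neq0 _ h (r_neq0 _ r_pow).
  by split=> [<-|->]; rewrite ?mulfK ?divfK.
apply: (has_card_sum (g := fun r u => [ffun i => u (p i) * r i])
  (Q := Q) has_card_ratios).
- move=> r [_ r_pow _]; apply: has_card_torus => // h.
  by rewrite ffunE mulf_neq0 ?invr_eq0 ?K_neq0 //; apply: r_neq0.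
- move=> r u [r_b r_pow r_inj] [u0 /ffunP uE]; have r0 := r_neq0 _ r_pow; split.
  + by move=> i; rewrite ffunE mulf_neq0.
  + move=> i; apply/(eqn_split r u) => //.
      by rewrite ffunE exprMn r_pow mulr1.
    by rewrite uE ffunE.
  + move=> i j pij; rewrite !ffunE pij => /(mulfI (u0 _)); exact: r_inj.
- move=> z [z0 zE z_inj].
  (* The coupling product and the right-hand side depend on [i] only through its string, so
     comparing the equations of [i] and of its base index isolates the powers. *)
  have z_pow i : z i ^+ M (p i) = z (b (p i)) ^+ M (p i).
    have K0 := K_neq0 z (p i) z0; apply: (mulIf K0).
    by have := zE (b (p i)); rewrite /K bK zE => ->.
  pose u : {ffun 'I_n -> C} := [ffun h => z (b h)].
  pose r : {ffun I -> C} := [ffun i => z i / z (b (p i))].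
  have zur : z = [ffun i => u (p i) * r i].
    by apply/ffunP => i; rewrite !ffunE mulrC divfK.
  have r_pow i : r i ^+ M (p i) = 1.
    by rewrite ffunE expr_div_n z_pow divff // expf_neq0.
  exists r, u; split=> //.
    split=> // [h|i j pij]; first by rewrite ffunE bK divff.
    rewrite !ffunE pij => /(mulIf _) e; apply: z_inj => //.
    by apply: e; rewrite invr_eq0.
  have u0 h : u h != 0 by rewrite ffunE.
  split=> //; apply/ffunP => h; rewrite [RHS]ffunE.
  apply/(@eqn_split r u h (z (b h))) => //; first by rewrite ffunE.
  by rewrite -zur; have := zE (b h); rewrite bK.
- move=> r u r' u' [r_b _ _] [u0 _] [r'_b _ _] _ /ffunP e.
  have eu : u = u'.
    by apply/ffunP => h; have := e (b h); rewrite !ffunE r_b r'_b !bK !mulr1.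
  split=> //; apply/ffunP => i; have := e i; rewrite !ffunE -eu; exact: mulfI.
Qed.

End StringSystems.

(** * Positive definite matrices *)

Section PositiveDefinite.
Variable R : realFieldType.

Definition posdef n (X : 'M[R]_n) : Prop :=
  forall v : 'rV_n, v != 0 -> 0 < (v *m X *m v^T) 0 0.

Lemma quadE n (X : 'M[R]_n) (v : 'rV_n) :
  (v *m X *m v^T) 0 0 = \sum_i \sum_j v 0 i * v 0 j * X i j.
Proof.
rewrite mxE exchange_big; apply: eq_bigr => j _; rewrite !mxE mulr_suml.
by apply: eq_bigr => i _; rewrite mulrAC.
Qed.

(* The Schur complement of the first entry is again positive definite. *)
Lemma posdef_det_gt0 n (X : 'M[R]_n) : posdef X -> 0 < \det X.
Proof.
elim: n X => [|n IHn] X pdX; first by rewrite det_mx00.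
pose a := X 0 0; change 'M[R]_(1 + n) in X; change (@posdef (1 + n) X) in pdX.
change (0 < @determinant R (1 + n) X).
pose r := ursubmx X; pose c := dlsubmx X; pose Y := drsubmx X.
have ulE : ulsubmx X = a%:M.
  by rewrite [LHS]mx11_scalar !mxE; congr (X _ _)%:M; apply: val_inj.
have XE : X = block_mx a%:M r c Y by rewrite -ulE submxK.
have a_gt0 : 0 < a.
  have /pdX : row_mx (1%:M : 'M[R]_1) (0 : 'rV_n) != 0.
    by apply/eqP => /(congr1 lsubmx); rewrite row_mxKl linear0 => /eqP; rewrite oner_eq0.
  rewrite XE mul_row_block tr_row_mx mul_row_col trmx0 mulmx0 addr0 mul0mx addr0.
  by rewrite mul1mx trmx1 mulmx1 mxE eqxx.
have a_neq0 := lt0r_neq0 a_gt0.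
pose S := Y - a^-1 *: (c *m r).
have -> : \det X = a * \det S.
  (* One step of Gaussian elimination: a unitriangular factor clears the first column below [a]. *)
  have <- : \det (block_mx 1%:M 0 (- a^-1 *: c) 1%:M *m X) = \det X.
    by rewrite det_mulmx det_lblock !det1 !mul1r.
  rewrite XE mulmx_block !mul1mx !mul0mx !addr0 mul_mx_scalar scalerA mulrN.
  rewrite mulfV // scaleN1r addNr det_ublock det_scalar1 /S.
  by rewrite -scalemxAl scaleNr addrC.
apply: mulr_gt0 => //; apply: IHn => y y0.
(* This [x] makes the first entry of the row (x, y) X vanish, so the form of [X] at (x, y) equals
   the form of [S] at [y]. *)
pose x : 'M_1 := - a^-1 *: (y *m c).
have /pdX : row_mx x y != 0.
  by apply: contra_neq y0 => /(congr1 rsubmx); rewrite row_mxKr linear0.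
rewrite XE mul_row_block mul_mx_scalar scalerA mulrN mulfV // scaleN1r addNr.
rewrite tr_row_mx mul_row_col mul0mx add0r.
suff -> : x *m r + y *m Y = y *m S by [].
by rewrite /S mulmxBr -scalemxAr mulmxA -scalemxAl scaleNr addrC.
Qed.

(* Writing [y_a = v_a / w_a], each off-diagonal term is bounded by
   [2 y_a y_b <= y_a ^ 2 + y_b ^ 2]. *)
Lemma posdef_dominant n (G : 'M[R]_n) (w : 'I_n -> R) :
  (forall a b, G a b = G b a) -> (forall a b, a != b -> G a b <= 0) ->
  (forall a, 0 < w a) -> (forall a, 0 < \sum_b G a b * w b) -> posdef G.
Proof.
move=> symG offG w0 Gw0 v v0; rewrite quadE.
pose y a := v 0 a / w a.
have vE a : v 0 a = w a * y a by rewrite mulrC divfK ?gt_eqF.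
have lb a b : G a b * w a * w b * (y a ^+ 2 + y b ^+ 2) / 2
    <= v 0 a * v 0 b * G a b.
  rewrite !vE; have [->|/offG Gab] := eqVneq a b.
    by rewrite le_eqVlt; apply/orP; left; apply/eqP; field.
  have : 0 <= - G a b * (w a * w b) * (y a - y b) ^+ 2.
    by rewrite mulr_ge0 ?sqr_ge0 // mulr_ge0 ?oppr_ge0 // mulr_ge0 // ltW.
  lra.
have sumE : \sum_a \sum_b G a b * w a * w b * (y a ^+ 2 + y b ^+ 2) / 2
    = \sum_a w a * y a ^+ 2 * \sum_b G a b * w b.
  have split2 a b : G a b * w a * w b * (y a ^+ 2 + y b ^+ 2) / 2
      = w a * y a ^+ 2 * (G a b * w b) / 2 + w b * y b ^+ 2 * (G b a * w a) / 2.
    by rewrite (symG b a); field.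
  under eq_bigr => a _ do under eq_bigr => b _ do rewrite split2.
  under eq_bigr => a _ do rewrite big_split.
  rewrite big_split /= [X in _ + X]exchange_big -big_split; apply: eq_bigr => a _.
  by rewrite /= -big_split mulr_sumr; apply: eq_bigr => b _ /=; field.
apply: (lt_le_trans _ (ler_sum _ (fun a _ => ler_sum _ (fun b _ => lb a b)))).
rewrite sumE; have [a va] : exists a, v 0 a != 0.
  apply/existsP; apply: contra_neqT v0; rewrite negb_exists => /forallP v0.
  by apply/rowP => a; rewrite mxE; apply/eqP; rewrite -[_ == _]negbK.
rewrite (bigD1 a) //= ltr_pwDl //.
  rewrite mulr_gt0 // mulr_gt0 // lt0r sqr_ge0 andbT expf_neq0 //.
  by rewrite mulf_neq0 // invr_eq0 gt_eqF.
apply: sumr_ge0 => b _; apply: mulr_ge0 (ltW (Gw0 b)).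
exact: mulr_ge0 (ltW (w0 b)) (sqr_ge0 _).
Qed.

(* [minn x y] counts the [t] below both [x] and [y], so the form is a sum over
   [t] of values of the form [G]. *)
Lemma posdef_minn n q (G : 'M[R]_n) (al : 'I_q -> 'I_n) (x : 'I_q -> nat) :
  posdef G -> (forall h, 0 < x h)%N ->
  (forall h k, al h = al k -> x h = x k -> h = k) ->
  posdef (\matrix_(h, k) (G (al h) (al k) * (minn (x h) (x k))%:R)).
Proof.
move=> pdG x0 inj v v0; rewrite quadE.
pose T := (\max_h x h)%N.
pose w (t : 'I_T) : 'rV[R]_n := \row_a \sum_(h | al h == a) v 0 h * (t < x h)%:R.
have minE h k : (minn (x h) (x k))%:R
    = \sum_(t < T) (t < x h)%:R * (t < x k)%:R :> R.
  have le : (minn (x h) (x k) <= T)%N by rewrite geq_min leq_bigmax.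
  under eq_bigr => t _ do rewrite -natrM mulnb -leq_min.
  by rewrite -natr_sum -big_mkcond (big_ord_narrow le) sum1_card card_ord.
have wE t (f : 'I_n -> R) :
    \sum_a w t 0 a * f a = \sum_h v 0 h * (t < x h)%:R * f (al h).
  rewrite [RHS](partition_big al predT) //=; apply: eq_bigr => a _.
  by rewrite mxE mulr_suml; apply: eq_bigr => h /eqP ->.
have -> : \sum_h \sum_k v 0 h * v 0 k
      * (\matrix_(h, k) (G (al h) (al k) * (minn (x h) (x k))%:R)) h k
    = \sum_(t < T) (w t *m G *m (w t)^T) 0 0.
  have quad_wE t : (w t *m G *m (w t)^T) 0 0 = \sum_h v 0 h * (t < x h)%:R *
      \sum_k v 0 k * (t < x k)%:R * G (al h) (al k).
    rewrite -(wE t (fun a => \sum_k v 0 k * (t < x k)%:R * G a (al k))) quadE.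
    apply: eq_bigr => a _; rewrite -(wE t (G a)) mulr_sumr.
    by apply: eq_bigr => b _; rewrite mulrA.
  under [RHS]eq_bigr => t _ do rewrite quad_wE.
  rewrite [RHS]exchange_big; apply: eq_bigr => h _ /=.
  under [RHS]eq_bigr => t _ do rewrite mulr_sumr.
  rewrite [RHS]exchange_big; apply: eq_bigr => k _ /=.
  rewrite mxE minE !mulr_sumr; apply: eq_bigr => t _; ring.
have [h0 vh0] : exists a, v 0 a != 0.
  apply/existsP; apply: contra_neqT v0; rewrite negb_exists => /forallP v0.
  by apply/rowP => a; rewrite mxE; apply/eqP; rewrite -[_ == _]negbK.
(* Take [h] with [x h] maximal among the nonzero coordinates. In the layer t = x h - 1, coordinate
   [al h] of [w t] is then just [v 0 h]: another contributor would have the same [al] and the same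
   [x], against injectivity. *)
case: (arg_maxnP (P := fun h => v 0 h != 0) x vh0) => h vh hmax.
have w_ge0 t : 0 <= (w t *m G *m (w t)^T) 0 0.
  have [->|/pdG/ltW//] := eqVneq (w t) 0; by rewrite !mul0mx mxE.
have ltT : ((x h).-1 < T)%N by rewrite prednK // leq_bigmax.
rewrite (bigD1 (Ordinal ltT)) //= ltr_pwDl ?sumr_ge0 //.
apply: pdG; apply: contra_neq vh => /rowP/(_ (al h)); rewrite !mxE (bigD1 h) //=.
rewrite prednK // leqnn mulr1 big1 ?addr0 // => k /andP[/eqP ak nek].
have [->|/hmax le_k] := eqVneq (v 0 k) 0; first by rewrite mul0r.
case: leqP => [ge_k|]; last by rewrite mulr0.
by case/negP: nek; apply/eqP/inj => //; apply/eqP; rewrite eqn_leq ge_k andbT.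
Qed.

Lemma posdef_diagD n (d : 'rV[R]_n) (X : 'M[R]_n) :
  (forall i, 0 <= d 0 i) -> posdef X -> posdef (diag_mx d + X).
Proof.
move=> d0 pdX v v0; rewrite mulmxDr mulmxDl mxE ltr_wpDl ?pdX // quadE.
apply: sumr_ge0 => i _; rewrite (bigD1 i) //= mxE eqxx mulr1n big1 => [|j].
  by rewrite addr0 mulr_ge0 // -expr2 sqr_ge0.
by rewrite eq_sym mxE => /negPf ->; rewrite mulr0n mulr0.
Qed.

End PositiveDefinite.

(** * Cartan matrices *)

Definition simple_rank (X : simple_type) : nat :=
  match X with
  | TA n | TB n | TC n | TD n | TE n => n | TF4 => 4 | TG2 => 2
  end.

(** [TB] is accepted in low rank because the invariant subalgebra of type A^(2)_2 is B_1, and that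
    of A^(2)_4 and D^(2)_3 is B_2. *)
Definition simple_valid (X : simple_type) : bool :=
  match X with
  | TC n => 2 <= n | TD n => 4 <= n
  | TE n => (n == 6) || (n == 7) || (n == 8)
  | _ => true
  end%N.

Local Notation node X a := (1 <= a <= simple_rank X)%N.

Lemma chain_adjC i j : chain_adj i j = chain_adj j i.
Proof. by rewrite /chain_adj orbC. Qed.

Lemma E_adjC i j : E_adj i j = E_adj j i.
Proof.
have E x y : (i == x) && (j == y) || (i == y) && (j == x)
    = (j == x) && (i == y) || (j == y) && (i == x).
  by rewrite orbC; congr (_ || _); rewrite andbC.
by rewrite /E_adj /= (E 1) (E 3) (E 4) (E 5) (E 6) (E 7) (E 2).
Qed.

Lemma D_adjC n i j : D_adj n i j = D_adj n j i.
Proof.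
rewrite /D_adj /= chain_adjC -!orbA -!andbA [in LHS](andbC (i <= _)%N).
by congr (_ || _); rewrite orbC [(i == n) && _]andbC [(i == _) && _]andbC.
Qed.

Lemma cartan_sym X a b : simple_valid X -> node X a -> node X b ->
  (symmetrizer X b)%:Z * cartan X b a = (symmetrizer X a)%:Z * cartan X a b.
Proof.
rewrite /cartan /= => vX aX bX.
case: X vX aX bX => [n|n|n|n|n||] /= vX aX bX; rewrite ?aX ?bX /= [a == b]eq_sym;
  case: (eqVneq b a) => [e|/eqP ne]; do ?by rewrite ?e.
- by rewrite chain_adjC.
- rewrite /chain_adj; repeat case: ifP => ?; lia.
- rewrite /chain_adj; repeat case: ifP => ?; lia.
- by rewrite D_adjC.
- by rewrite E_adjC.
- rewrite /chain_adj; repeat case: ifP => ?; lia.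
- repeat case: ifP => ?; lia.
Qed.

Lemma cartan_offdiag X a b : a != b -> cartan X a b <= 0.
Proof.
move=> /negPf ne; rewrite /cartan /= ne; case: ifP => // _.
by case: X => * //; do ?case: ifP.
Qed.

Lemma cartan_diag X a : node X a -> cartan X a a = 2.
Proof. by rewrite /cartan eqxx; case: X => [n|n|n|n|n||] /= ->. Qed.

(** Of two different root lengths one is 1. If it is that of [b], the symmetry of the symmetrized
    matrix gives the divisibility; otherwise the divisor is 1. *)
Lemma cartan_dvd X a b : simple_valid X -> node X a -> node X b ->
  symmetrizer X a != symmetrizer X b -> (symmetrizer X a %| `|cartan X b a|)%N.
Proof.
rewrite /cartan /= => vX aX bX.
case: X vX aX bX => [n|n|n|n|n||] //= vX aX bX; rewrite ?aX ?bX /=;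
  rewrite /chain_adj; repeat (case: ifP => //= ?); lia.
Qed.

(** Isolates the diagonal term of a Cartan row and its at most three neighbours [p], [q], [r]. A
    neighbour outside 1..n, such as the placeholder 0, only weakens the bound, since the subtracted
    values are nonnegative. *)
Lemma sum_ge_nodes n (f : nat -> int) (a p q r : nat) (x yp yq yr : int) :
  (1 <= a <= n)%N -> 0 <= yp -> 0 <= yq -> 0 <= yr ->
  (forall b, (1 <= b <= n)%N ->
     x *+ (b == a) - yp *+ (b == p) - yq *+ (b == q) - yr *+ (b == r) <= f b) ->
  x - yp - yq - yr <= \sum_(b < n) f b.+1.
Proof.
move=> aP yp0 yq0 yr0 le_f.
have sum_le (y : int) c : 0 <= y -> \sum_(b < n) y *+ (b.+1 == c) <= y.
  move=> y0; case: c => [|c]; first by rewrite big1 // => b _; rewrite mulr0n.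
  have [lt_cn|ge_cn] := ltnP c n.
    rewrite (bigD1 (Ordinal lt_cn)) //= eqxx big1 ?addr0 // => b ne.
    by rewrite eqSS -[(b : nat) == c]/(b == Ordinal lt_cn) (negPf ne).
  rewrite big1 // => b _; rewrite eqSS; case: eqP => // bc.
  by have := ltn_ord b; rewrite bc ltnNge ge_cn.
have -> : x = \sum_(b < n) x *+ (b.+1 == a).
  case: a aP {le_f} => // c /= lt_cn.
  rewrite (bigD1 (Ordinal lt_cn)) //= eqxx big1 ?addr0 // => b ne.
  by rewrite eqSS -[(b : nat) == c]/(b == Ordinal lt_cn) (negPf ne).
apply: (@le_trans _ _ (\sum_(b < n) (x *+ (b.+1 == a) - yp *+ (b.+1 == p)
    - yq *+ (b.+1 == q) - yr *+ (b.+1 == r)))); last first.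
  by apply: ler_sum => b _; apply: le_f => /=.
rewrite !sumrB.
exact: lerB (lerB (lerB (lexx _) (sum_le _ p yp0)) (sum_le _ q yq0)) (sum_le _ r yr0).
Qed.

(** Equal to a (2n - a): zero at 0, with second difference -2, and increasing up to n, which covers
    both ends of a chain. *)
Definition parab (n a : nat) : int := n%:Z ^+ 2 - (n%:Z - a%:Z) ^+ 2.

(* In the exceptional types these are the coefficients of the sum of the positive
   roots (those of [E_8] also serve for [E_6] and [E_7]); in the classical types a
   sequence that is concave along the chain is enough. *)
Definition dominant_vec (X : simple_type) (a : nat) : int :=
  match X with
  | TA n | TB n => parab n a
  | TC n => if a == n then parab n a else 2 * parab n a
  | TD n => if (n.-1 <= a)%N then parab n.-1 n.-1 else 2 * parab n.-1 a
  | TE _ => nth 0 [:: 0; 92; 136; 182; 270; 220; 168; 114; 58] a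
  | TF4 => nth 0 [:: 0; 16; 30; 42; 22] a
  | TG2 => nth 0 [:: 0; 10; 6] a
  end.

Lemma dominant_vec_gt0 X a : simple_valid X -> node X a -> 0 < dominant_vec X a.
Proof.
case: X => [n|n|n|n|n||] /= vX aX; rewrite /parab.
- nia.
- nia.
- case: ifP; nia.
- case: ifP; nia.
- by case/orP: vX aX => [/orP[]|] /eqP->; do 9?case: a => // a.
- by move: aX; do 5?case: a => // a.
- by move: aX; do 3?case: a => // a.
Qed.

Local Ltac row_entry a b :=
  have [e|?] := eqVneq b a;
  [ by subst b; rewrite ?eqxx; repeat case: ifP => /= ?; lia
  | rewrite /=; repeat case: ifP => /= ?; try lia;
    repeat (case: eqP => ?; [subst b|]); lia ].

(** The vector pairs positively with every simple coroot, as the sum of the positive roots does. The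
    classical types follow from the differences of [parab], the exceptional ones from
    computation. *)
Lemma cartan_dominant X a : simple_valid X -> node X a ->
  0 < \sum_(b < simple_rank X) cartan X a b.+1 * dominant_vec X b.+1.
Proof.
move=> vX aX; pose f b := cartan X a b * dominant_vec X b.
have u_ge0 n b : (b <= n)%N -> 0 <= parab n b by rewrite /parab => ?; nia.
have uS n b : parab n b.+1 - parab n b = 2 * n%:Z - 2 * b%:Z - 1.
  by rewrite /parab -[b.+1]addn1 PoszD; ring.
have uB n b : (0 < b)%N ->
    parab n b - parab n b.-1 = 2 * n%:Z - 2 * b%:Z + 1.
  by case: b => // b _; rewrite uS; lia.
case: X aX vX @f => [n|n|n|n|n||] aX vX f; rewrite /= in aX vX.
- apply: lt_le_trans (@sum_ge_nodes n f a a.-1 a.+1 0%N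
    (2 * parab n a) (parab n a.-1) (if a == n then 0 else parab n a.+1) 0 aX _ _ _ _) => //.
  + have := uB n a; have := uS n a; have := u_ge0 n a; case: eqP => e; lia.
  + by apply: u_ge0; lia.
  + by case: eqP => // ?; apply: u_ge0; lia.
  + move=> b bX; rewrite /f /cartan /= aX bX /= /chain_adj.
    row_entry a b.
- apply: lt_le_trans (@sum_ge_nodes n f a a.-1 a.+1 0%N (2 * parab n a)
    (if a == n then 2 * parab n a.-1 else parab n a.-1)
    (if a == n then 0 else parab n a.+1) 0 aX _ _ _ _) => //.
  + by have := uB n a; have := uS n a; case: eqP => e; lia.
  + by have := u_ge0 n a.-1; case: eqP => ?; lia.
  + by case: eqP => // ?; apply: u_ge0; lia.
  + move=> b bX; rewrite /f /cartan /= aX bX /= /chain_adj.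
    row_entry a b.
- apply: lt_le_trans (@sum_ge_nodes n f a a.-1 a.+1 0%N
    (if a == n then 2 * parab n a else 4 * parab n a) (2 * parab n a.-1)
    (if a == n then 0 else 2 * parab n a.+1) 0 aX _ _ _ _) => //.
  + by have := uB n a; have := uS n a; case: eqP => e; lia.
  + by have := u_ge0 n a.-1; lia.
  + by have := u_ge0 n a.+1; case: eqP => ?; lia.
  + move=> b bX; rewrite /f /cartan /= aX bX /= /chain_adj.
    row_entry a b.
(* With n = m+2 the branch node is m. The end nodes m+1 and m+2 carry half values, so together they
   act on row m like one further node of the chain. *)
- case: n aX vX @f => [|[|m]] // aX vX f; pose v := parab m.+1.
  have v_ge0 b : (b <= m.+1)%N -> 0 <= v b by apply: u_ge0.
  have vS := uS m.+1 m; have vS' := uS m.+1 a; have vB := uB m.+1 a.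
  apply: lt_le_trans (@sum_ge_nodes m.+2 f a (if a == m.+2 then m else a.-1) a.+1 m.+2
    (if (m < a)%N then 2 * v m.+1 else 4 * v a)
    (2 * v (if a == m.+2 then m else a.-1))
    (if (m < a)%N then 0 else if a == m then v m.+1 else 2 * v a.+1)
    (if a == m then v m.+1 else 0) aX _ _ _ _) => //.
  + rewrite -/v in vS vS' vB; have [->|am] := eqVneq a m.+2.
      by rewrite leqnSn ifN; [lia | lia].
    have [e|am'] := eqVneq a m; first by subst a; rewrite ltnn; lia.
    case: ltnP => ?; last by lia.
    have e : a = m.+1 by lia.
    by subst a => /=; lia.
  + by rewrite mulr_ge0 // v_ge0 //; case: eqP => ?; lia.
  + case: ltnP => // ?; case: eqP => ?; rewrite ?mulr_ge0 // v_ge0 //; lia.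
  + by case: eqP => // _; apply: v_ge0.
  + move=> b bX; rewrite /f /cartan /= aX bX /= /D_adj /chain_adj /= -/v.
    row_entry a b.
- clear f; case/orP: vX aX => [/orP[]|] /eqP->; do 9?[case: a => // a];
    by rewrite /simple_rank !big_ord_recr big_ord0; vm_compute.
- case: a aX @f => [|[|[|[|[|a]]]]] // _ _;
    by rewrite /simple_rank !big_ord_recr big_ord0; vm_compute.
- case: a aX @f => [|[|[|a]]] // _ _;
    by rewrite /simple_rank !big_ord_recr big_ord0; vm_compute.
Qed.

Lemma g0_valid t : valid_type t -> simple_valid (g0_type t).
Proof. by case: t. Qed.

Lemma rank0E t : rank0 t = simple_rank (g0_type t).
Proof. by case: t. Qed.

Lemma symmetrizer_gt0 X a : (0 < symmetrizer X a)%N.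
Proof. by case: X => * //=; case: ifP. Qed.

Lemma dprime_gt0 t a : (0 < dprime t a)%N.
Proof. by rewrite /dprime; case: ifP => // _; apply: symmetrizer_gt0. Qed.

Lemma eps_gt0 t a : (0 < eps t a)%N.
Proof. by rewrite /eps; case: ifP. Qed.

Lemma eps_untwisted t a : twist t = 1%N -> (1 <= a <= rank0 t)%N -> eps t a = 1%N.
Proof.
move=> tw aX; rewrite /eps.
suff -> : cartan_g t a (sigma t a) = 2 by [].
by case: t tw aX => //= *; apply: cartan_diag.
Qed.

(** The value 2 occurs only for A^(2)_2n at node n, where sigma exchanges the adjacent nodes n and
    n+1; row n of the Cartan matrix of B_n is even. *)
Lemma eps_dvd t b a : valid_type t -> (1 <= b <= rank0 t)%N ->
  (eps t b %| `|cartan_g0 t b a|)%N.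
Proof.
move=> vt bX; have [/eps_untwisted -> //|tw] := eqVneq (twist t) 1%N.
rewrite /eps; case: ifP => // lt0.
case: t vt bX tw lt0 => //= [n|n|n||] vt bX _.
- case: (eqVneq b n) => [->|ne].
    by rewrite /cartan_g0 /cartan /chain_adj /= eqxx /=; repeat case: ifP => //= ?; lia.
  by rewrite /cartan /chain_adj /=; repeat case: ifP => //= ?; lia.
- by rewrite /cartan /chain_adj /=; repeat case: ifP => //= ?; lia.
- have [->|ne] := eqVneq b n; last first.
    by rewrite ifN ?cartan_diag //=; lia.
  by rewrite /cartan /D_adj /chain_adj /=; repeat case: ifP => //= ?; lia.
- by case: b bX => [|[|[|[|[|b]]]]].
- by case: b bX => [|[|[|b]]].
Qed.

(** * Integrality of the exponents and the symmetrized Cartan matrix *)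

Section AffineCartan.
Variable t : affine_type.
Hypothesis vt : valid_type t.
Local Notation X := (g0_type t).
Local Notation nd a := (1 <= a <= rank0 t)%N.

Definition Bexp (am bk : nat * nat) : rat :=
  (cartan_g0 t bk.1 am.1)%:~R / ((eps t bk.1)%:R * (dprime t am.1)%:R)
  * (minn (dprime t am.1 * am.2) (dprime t bk.1 * bk.2))%:R.

(** In the twisted case d' is 1 and [eps] divides the Cartan entry. In the untwisted case [eps] is
    1, and d' either comes out of the minimum (equal lengths) or divides the Cartan entry. *)
Lemma Bexp_int am bk : nd am.1 -> nd bk.1 -> Bexp am bk \is a Num.int.
Proof.
case: am bk => [a m] [b k] /= aX bX; rewrite /Bexp /=.
have dvd_int (x : int) (y : nat) : (0 < y)%N -> (y %| `|x|)%N ->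
    x%:~R / y%:R \is a @Num.int rat.
  by move=> y0 dv; rewrite -[y%:R]/(y%:Z%:~R) Qint_dvdz.
have [tw|tw] := eqVneq (twist t) 1%N; last first.
  rewrite /dprime (negPf tw) mulr1 rpredM ?natr_int ?intr_int //.
  exact: dvd_int (eps_gt0 _ _) (eps_dvd _ vt bX).
rewrite eps_untwisted // mul1r /dprime tw eqxx.
have [<-|ne] := eqVneq (symmetrizer X a) (symmetrizer X b).
  rewrite -minnMr natrM mulrA divfK ?pnatr_eq0 -?lt0n ?symmetrizer_gt0 //.
  by rewrite rpredM ?natr_int ?intr_int.
rewrite rpredM ?natr_int //; apply: dvd_int (symmetrizer_gt0 _ _) _.
by rewrite cartan_dvd ?g0_valid -?rank0E.
Qed.

(** Up to scale, the Gram matrix of the simple roots divided by the d'; this normalization is the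
    one that appears when the columns of F are rescaled. *)
Definition cartan_form : 'M[rat]_(rank0 t) :=
  \matrix_(a, b) ((symmetrizer X b.+1)%:R * (cartan_g0 t b.+1 a.+1)%:~R
    / ((dprime t a.+1)%:R * (dprime t b.+1)%:R)).

Lemma posdef_cartan_form : posdef cartan_form.
Proof.
have nX (a : 'I_(rank0 t)) : (1 <= a.+1 <= simple_rank X)%N by rewrite -rank0E /= ltn_ord.
have vX := g0_valid vt.
have d0 a : 0 < (dprime t a)%:R :> rat by rewrite ltr0n dprime_gt0.
have s0 a : 0 < (symmetrizer X a)%:R :> rat by rewrite ltr0n symmetrizer_gt0.
have symE (a b : 'I_(rank0 t)) : (symmetrizer X b.+1)%:R * (cartan_g0 t b.+1 a.+1)%:~R
    = (symmetrizer X a.+1)%:R * (cartan_g0 t a.+1 b.+1)%:~R :> rat.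
  have := cartan_sym vX (nX a) (nX b) => /(congr1 (fun x : int => x%:~R : rat)).
  by rewrite !rmorphM.
(* The factor d' of the weight cancels one denominator, so the weighted row sum is a positive
   multiple of the sum in [cartan_dominant]. *)
apply: (@posdef_dominant _ _ _
  (fun a => (dprime t a.+1)%:R * (dominant_vec X a.+1)%:~R)).
- by move=> a b; rewrite !mxE symE; congr (_ / _); rewrite mulrC.
- move=> a b ne; rewrite mxE pmulr_lle0 ?invr_gt0 ?mulr_gt0 // pmulr_rle0 //.
  by rewrite lerz0 cartan_offdiag // eqSS eq_sym.
- by move=> a; rewrite mulr_gt0 // ltr0z dominant_vec_gt0.
- move=> a.
  have := cartan_dominant vX (nX a); rewrite -(ltr0z rat) rmorph_sum /=.
  rewrite -(pmulr_rgt0 _ (divr_gt0 (s0 a.+1) (d0 a.+1))).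
  rewrite mulr_sumr -rank0E.
  set S1 := \sum_(i < _) _; set S2 := \sum_b _; suff -> : S1 = S2 by [].
  apply: eq_bigr => b _; rewrite mxE symE rmorphM /=; field.
  by rewrite !gt_eqF.
Qed.
End AffineCartan.

(** * The string center equation *)

Section Reduction.
Variables (t : affine_type) (K : nat) (nu N : famH).
Hypothesis vt : valid_type t.
Local Notation Hp := (Hprime t K N).
Local Notation Z := (zindex t K N).
Local Notation P am := (Pvac t K nu N am.1 am.2).
Local Notation nat_N am := (N am.1 am.2).
Hypothesis P_ge0 : forall am, am \in Hp -> 0 <= P am.
Local Notation nH h := (nth (0, 0)%N Hp h).
Local Notation nZ i := (nth ((0, 0), 0)%N Z i).

Lemma mem_Hprime am : (am \in Hp) =
  [&& (1 <= am.1 <= rank0 t)%N, (1 <= am.2 <= K)%N & (0 < nat_N am)%N].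
Proof.
rewrite mem_filter andbC andbA; congr (_ && _); case: am => a m.
apply/allpairsP/andP => [[[a' m'] [/= + + [-> ->]]]|[aX mX]].
  by rewrite !mem_iota !add1n !ltnS.
by exists (a, m); rewrite !mem_iota !add1n !ltnS.
Qed.

Lemma uniq_Hprime : uniq Hp.
Proof.
rewrite filter_uniq // allpairs_uniq ?iota_uniq // => -[a m] [a' m'] _ _ [-> ->].
by [].
Qed.

Lemma mem_zindex x :
  (x \in Z) = (x.1 \in Hp) && (1 <= x.2 <= nat_N x.1)%N.
Proof.
apply/allpairsPdep/andP => [[am [al [amH + ->]]]|[xH xN]].
  by rewrite mem_iota add1n ltnS.
by exists x.1, x.2; rewrite mem_iota add1n ltnS; case: (x) xH xN.
Qed.

Lemma uniq_zindex : uniq Z.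
Proof.
apply: allpairs_uniq_dep => [|am _|]; rewrite ?uniq_Hprime ?iota_uniq //.
by move=> [am al] [am' al'] _ _ /= [-> ->].
Qed.

Lemma Pvac_int am : (1 <= am.1 <= rank0 t)%N -> P am \is a Num.int.
Proof.
case: am => a m /= aX; rewrite /Pvac rpredB // /gammaH.
  by apply: rpred_sum => k _; rewrite rpredM ?natr_int.
rewrite big_nat_cond; apply: rpred_sum => b /andP[bX _].
apply: rpred_sum => k _; rewrite rpredM ?natr_int // minnC.
(* The coefficients of [Pvac] are those of [Bexp] with the two pairs exchanged. *)
by have := @Bexp_int t vt (b, k) (a, m) bX aX.
Qed.

Local Notation n := (size Hp).

Lemma nHP (h : 'I_n) :
  [/\ nH h \in Hp, (1 <= (nH h).1 <= rank0 t)%N & (0 < nat_N (nH h))%N].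
Proof.
have hH : nH h \in Hp by apply: mem_nth.
by move: (hH); rewrite {1}mem_Hprime => /and3P[].
Qed.

Lemma nH_inj (h k : 'I_n) : nH h = nH k -> h = k.
Proof. by move/eqP; rewrite nth_uniq ?uniq_Hprime // => /eqP/val_inj. Qed.

Definition string_order (h : 'I_n) : nat :=
  `|numq (P (nH h) + (nat_N (nH h))%:R)|%N.

Lemma string_orderE (h : 'I_n) : (string_order h)%:R = P (nH h) + (nat_N (nH h))%:R :> rat.
Proof.
have [hH hX hN] := nHP h.
have PN0 : 0 <= P (nH h) + (nat_N (nH h))%:R by rewrite addr_ge0 ?P_ge0.
rewrite /string_order natr_absz ger0_norm ?numq_ge0 // numqK //.
by rewrite rpredD ?natr_int ?Pvac_int.
Qed.

Lemma string_order_ge (h : 'I_n) : (nat_N (nH h) <= string_order h)%N.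
Proof.
have [hH _ _] := nHP h.
by rewrite -(ler_nat rat) string_orderE lerDr P_ge0.
Qed.

(** The term - delta_ab delta_mk of the exponent does not involve alpha and beta, so it belongs to
    the coupling between strings. *)
Definition string_coupling (h k : 'I_n) : int :=
  numq (Bexp t (nH h) (nH k)) - (h == k)%:Z.

Local Notation F := (\matrix_(h < n, k < n) Fmat t K nu N (nH h) (nH k)).

Lemma FmatE am bk :
  Fmat t K nu N am bk = P am *+ (am == bk) + Bexp t am bk * (nat_N bk)%:R.
Proof.
by case: am bk => [a m] [b k]; rewrite /Fmat /Bexp -pair_eqE /=; case: ifP.
Qed.

Lemma det_Fmat_gt0 : 0 < \det F.
Proof.
pose d' a : rat := (dprime t a)%:R; pose e a : rat := (eps t a)%:R.
pose s a : rat := (symmetrizer (g0_type t) a)%:R.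
pose Nr (h : 'I_n) : rat := (nat_N (nH h))%:R.
have d'0 a : 0 < d' a by rewrite ltr0n dprime_gt0.
have e0 a : 0 < e a by rewrite ltr0n eps_gt0.
have s0 a : 0 < s a by rewrite ltr0n symmetrizer_gt0.
have N0 h : 0 < Nr h by rewrite ltr0n; case: (nHP h).
(* Scaling column k by [g k / Nr k] removes [eps] and the multiplicity and brings in s / d', which
   makes the second summand of F symmetric. *)
pose g (h : 'I_n) : rat := e (nH h).1 * s (nH h).1 / d' (nH h).1.
have g0 h : 0 < g h by rewrite divr_gt0 ?mulr_gt0.
have al_lt (h : 'I_n) : ((nH h).1.-1 < rank0 t)%N by case: (nHP h) => _; lia.
pose al h := Ordinal (al_lt h).
have alS h : (al h).+1 = (nH h).1 by case: (nHP h) => _ /=; lia.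
pose x (h : 'I_n) := (dprime t (nH h).1 * (nH h).2)%N.
have pdX := posdef_diagD (d := \row_h (P (nH h) * g h / Nr h)) _
  (@posdef_minn _ _ _ (cartan_form t) al x (posdef_cartan_form vt) _ _).
have XE : F *m diag_mx (\row_k (g k / Nr k)) = diag_mx (\row_h (P (nH h) * g h / Nr h))
    + \matrix_(h, k) (cartan_form t (al h) (al k) * (minn (x h) (x k))%:R).
  apply/matrixP => h k; rewrite mul_mx_diag !mxE FmatE /Bexp !alS.
  have -> : (nH h == nH k) = (h == k) by apply/eqP/eqP => [/nH_inj|->].
  rewrite -/(d' _) -/(d' _) -/(e _) -/(s _) -/(x h) -/(x k) -/(Nr k).
  have [<-|_] := eqVneq h k; rewrite ?mulr1n ?mulr0n /g; field;
    by do ?[apply/andP; split]; apply: lt0r_neq0; first [exact: e0 | exact: N0 | exact: d'0].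
have : 0 < \det (F *m diag_mx (\row_k (g k / Nr k))).
  rewrite XE; apply/posdef_det_gt0/pdX.
  - move=> h; have [hH _ _] := nHP h; rewrite mxE.
    exact: divr_ge0 (mulr_ge0 (P_ge0 hH) (ltW (g0 h))) (ltW (N0 h)).
  - move=> h; rewrite muln_gt0 dprime_gt0.
    by case: (nHP h) => /[!mem_Hprime] /and3P[_ /andP[->]].
  - move=> h k /(congr1 (fun a : 'I_(rank0 t) => a.+1)); rewrite !alS => e1.
    rewrite /x e1 => /eqP; rewrite eqn_pmul2l ?dprime_gt0 // => /eqP e2.
    by apply: nH_inj; rewrite [LHS]surjective_pairing e1 e2 -surjective_pairing.
rewrite det_mulmx pmulr_lgt0 // det_diag prodr_gt0 // => h _.
by rewrite mxE divr_gt0.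
Qed.

Lemma Hprime_zindex (i : 'I_(size Z)) : (nZ i).1 \in Hp.
Proof. by have := mem_nth ((0, 0), 0)%N (ltn_ord i); rewrite mem_zindex => /andP[]. Qed.

Lemma string_of_subproof (i : 'I_(size Z)) : (index (nZ i).1 Hp < n)%N.
Proof. by rewrite index_mem Hprime_zindex. Qed.

Definition string_of (i : 'I_(size Z)) : 'I_n := Ordinal (string_of_subproof i).

Lemma nH_string_of i : nH (string_of i) = (nZ i).1.
Proof. by rewrite nth_index // Hprime_zindex. Qed.

Lemma string_of_eq i j : (string_of i == string_of j) = ((nZ i).1 == (nZ j).1).
Proof.
by rewrite -!nH_string_of; apply/eqP/eqP => [->|/nH_inj].
Qed.

Lemma nZ_eq (i j : 'I_(size Z)) : (nZ i == nZ j) = (i == j).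
Proof. by rewrite nth_uniq ?uniq_zindex. Qed.

Lemma string_base_subproof (h : 'I_n) : (index (nH h, 1%N) Z < size Z)%N.
Proof. by rewrite index_mem mem_zindex /=; case: (nHP h) => -> _ ->. Qed.

(** The base entry of a string is the one with alpha = 1, which exists because N is positive on
    [Hprime]. *)
Definition string_base (h : 'I_n) : 'I_(size Z) := Ordinal (string_base_subproof h).

Lemma string_baseK : cancel string_base string_of.
Proof.
move=> h; apply: nH_inj; rewrite nH_string_of nth_index //.
by rewrite -index_mem string_base_subproof.
Qed.

Lemma card_string (h : 'I_n) : #|[pred i | string_of i == h]| = nat_N (nH h).
Proof.
have -> : #|[pred i | string_of i == h]| = count (fun x => x.1 == nH h) Z.
  rewrite -sum1_card -sum1_count (big_nth ((0, 0), 0)%N) big_mkord.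
  apply: eq_bigl => i; rewrite inE -nH_string_of.
  by apply/eqP/eqP => [->|/nH_inj].
rewrite -size_filter -[RHS](size_iota 1) -[RHS](size_map (pair (nH h))).
apply/perm_size/uniq_perm; rewrite ?filter_uniq ?uniq_zindex //.
  by rewrite map_inj_uniq ?iota_uniq // => ? ? [].
move=> [am al]; rewrite mem_filter mem_zindex /=.
apply/andP/mapP => [[/eqP -> /andP[_ alN]]|[al' + [-> ->]]].
  by exists al; rewrite // mem_iota add1n ltnS.
by rewrite mem_iota add1n ltnS => ->; case: (nHP h) => ->.
Qed.

Lemma toZ_Aexp (i j : 'I_(size Z)) : toZ (Aexp t K nu N (nZ i) (nZ j))
  = (string_order (string_of i))%:Z *+ (i == j)
    + string_coupling (string_of i) (string_of j).
Proof.
have BI : Bexp t (nH (string_of i)) (nH (string_of j)) \is a Num.int.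
  by apply: Bexp_int => //; [case: (nHP (string_of i)) | case: (nHP (string_of j))].
(* The comparison takes place in [rat], where integrality ensures that [numq] loses nothing. *)
apply: (@intr_inj rat).
have -> : Aexp t K nu N (nZ i) (nZ j)
    = (string_order (string_of i))%:R *+ (i == j)
      + (Bexp t (nH (string_of i)) (nH (string_of j)) - (string_of i == string_of j)%:R).
  rewrite string_orderE string_of_eq -nZ_eq !nH_string_of.
  case: (nZ i) (nZ j) => [[a m] al] [[b k] be] /=; rewrite /Bexp /= -!pair_eqE /=.
  by rewrite -pair_eqE /= addrA; do 2?case: ifP.
rewrite numqK; last by rewrite rpredD ?rpredB ?rpredMn ?natr_int.
rewrite !rmorphD rmorphN rmorphMn /= numqK //.
Qed.

(** On the diagonal the string order contributes P + N and the -1 of the coupling contributes -N,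
    which leaves the P of F. *)
Lemma det_reduced : ((\det (reduced_mx string_of string_order string_coupling))%:~R : rat)
  = \det F.
Proof.
rewrite -det_map_mx; congr (\det _); apply/matrixP => h k; rewrite !mxE FmatE.
have BI : Bexp t (nH h) (nH k) \is a Num.int.
  by apply: Bexp_int => //; [case: (nHP h) | case: (nHP k)].
have -> : (nH h == nH k) = (h == k) by apply/eqP/eqP => [/nH_inj|->].
rewrite card_string rmorphD rmorphM rmorphB rmorphMn /= numqK // -!pmulrn.
rewrite string_orderE.
by case: eqP => [->|_] /=; rewrite ?mulr1n ?mulr0n; ring.
Qed.

Lemma has_card_SCE (R : realType) :
  has_card (fun z => is_SCE_solution t K nu N R z /\ off_diagonal t K N R z)
    ((\prod_(h < n) (string_order h).-1 ^_ (nat_N (nH h)).-1)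
      * `|\det (reduced_mx string_of string_order string_coupling)|)%N.
Proof.
have M0 h : (0 < string_order h)%N.
  by apply: leq_trans (string_order_ge h); case: (nHP h).
pose c (h : 'I_n) : R[i] :=
  (-1) ^ (toZ (Phat t K nu N (nH h).1 (nH h).2) + (nat_N (nH h))%:Z + 1).
have c0 h : c h != 0 by rewrite expfz_neq0 // oppr_eq0 oner_eq0.
have det0 : \det (reduced_mx string_of string_order string_coupling) != 0.
  by rewrite -(intr_eq0 rat) det_reduced lt0r_neq0 ?det_Fmat_gt0.
have := has_card_strings string_baseK M0 c0 det0.
under eq_bigr => h _ do rewrite card_string.
move=> card_z.
have SCE_E (z : {ffun 'I_(size Z) -> R[i]}) (i : 'I_(size Z)) : (forall i, z i != 0) ->
    \prod_j z j ^ toZ (Aexp t K nu N (nZ i) (nZ j))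
    = z i ^+ string_order (string_of i)
      * \prod_j z j ^ string_coupling (string_of i) (string_of j).
  move=> z0; under eq_bigr => j _ do rewrite toZ_Aexp expfzDr //.
  rewrite big_split (bigD1 i) //= eqxx big1 ?mulr1 // => j.
  by rewrite eq_sym => /negPf ->.
apply: (has_card_image (f := id) _ _ _ card_z).
- move=> z [z0 zE z_inj]; split; first split=> // i.
    by move=> /=; rewrite SCE_E // zE /c nH_string_of.
  move=> i j ij /z_inj -> //; apply/eqP; rewrite string_of_eq; exact/eqP.
- move=> z [[z0 zE] z_off]; exists z => //; split=> // [i|i j ij zij].
    by rewrite -SCE_E // zE /c nH_string_of.
  (* Off-diagonality only gives equal alpha; with equal strings, the index triples agree, hence so
     do the positions. *)
  apply/eqP; rewrite -nZ_eq; move/eqP: ij; rewrite string_of_eq => /eqP ij.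
  by apply/eqP; rewrite [LHS]surjective_pairing ij (z_off _ _ ij zij) -surjective_pairing.
- by [].
Qed.

End Reduction.

(** * Comparison with the formula for R *)

Lemma binomq_ffact (x j : nat) : (j <= x)%N ->
  binomq x%:R j = (x ^_ j)%:R / (j`!)%:R.
Proof.
move=> le_jx; rewrite /binomq ffact_prod natr_prod; congr (_ / _).
by apply: eq_bigr => i _; rewrite natrB // (leq_trans (ltnW (ltn_ord i))).
Qed.

Theorem theorem2p13 (t : affine_type) (K : nat) (nu N : famH) (R : realType) :
  valid_type t ->
  supported t K nu -> supported t K N ->
  (forall am, am \in Hprime t K N -> 0 <= Pvac t K nu N am.1 am.2) ->
  exists s : seq {ffun 'I_(size (zindex t K N)) -> R[i]},
    [/\ uniq s,
        (forall z, z \in s <->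
           is_SCE_solution t K nu N R z /\ off_diagonal t K N R z)
      & (size s)%:R / (\prod_(am <- Hprime t K N) (N am.1 am.2)`!)%:R
        = Rnum t K nu N].
Proof.
move=> vt _ _ P_ge0; have [s [us sP sz]] := has_card_SCE vt P_ge0 R.
exists s; split=> //; rewrite {}sz.
(* For empty [Hprime] the empty determinant and the empty product are both 1, so one formula covers
   both cases. *)
have RnumE : Rnum t K nu N
    = \det (\matrix_(i < size (Hprime t K N), j < size (Hprime t K N))
              Fmat t K nu N (nth (0, 0)%N (Hprime t K N) i) (nth (0, 0)%N (Hprime t K N) j))
      * \prod_(am <- Hprime t K N) ((N am.1 am.2)%:R^-1
          * binomq (Pvac t K nu N am.1 am.2 + (N am.1 am.2)%:R - 1) (N am.1 am.2).-1).
  rewrite /Rnum; case: eqP => // ->.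
  by rewrite big_nil det_mx00 mulr1.
have det_gt0 := det_Fmat_gt0 vt P_ge0.
rewrite RnumE -(det_reduced vt P_ge0) in det_gt0 *.
rewrite natrM natr_absz ger0_norm; last by rewrite -(ler0z rat) ltW.
rewrite mulrAC mulrC; congr (_ * _).
rewrite !(big_nth (0, 0)%N) !big_mkord !natr_prod -prodfV -big_split /=.
apply: eq_bigr => h _; have [hH _ N_gt0] := nHP h.
have M_ge := string_order_ge vt P_ge0 h.
have M_gt0 := leq_trans N_gt0 M_ge.
rewrite -(string_orderE vt P_ge0) -[_ - 1](natrB _ M_gt0) subn1 binomq_ffact; last first.
  by rewrite -!subn1 leq_sub2r.
(* For one string with N = q+1, dividing the falling factorial by N! = N q! gives 1/N times the
   binomial coefficient. *)
case: (N _ _) N_gt0 => // q _ /=; rewrite factS natrM invfM mulrCA mulrA.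
by rewrite mulrC mulrA.
Qed.
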